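(* Let $X\in 2^\omega$ be a real with $X \geq_{tt} 0'$. Then there exists a real $Y$ such that $Y \oplus 0' \equiv_{tt} Y' \equiv_{tt} X$.
   Context: Reals are elements of $2^\omega$. A Turing functional $\Phi$ is a truth-table reduction if there is a computable $f:\omega\to\omega$ such that for every $n$ and every binary string $\sigma$ of length $f(n)$, $\Phi^\sigma(n)$ converges; $A\leq_{tt}B$ means $\Phi(B)=A$ for some truth-table reduction $\Phi$, and $A\equiv_{tt}B$ means $A\leq_{tt}B$ and $B\leq_{tt}A$. $Y'$ denotes the Turing jump of $Y$, $0'$ the halting set, and $A\oplus B=\{2n:n\in A\}\cup\{2n+1:n\in B\}$. *)

(* Defs.v *)
From Stdlib Require Import Arith List Bool ClassicalEpsilon.
From Stdlib Require Cantor.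
Import ListNotations.

Definition real := nat -> bool.

Definition pair (a b : nat) : nat := Cantor.to_nat (a, b).
Definition unpair (n : nat) : nat * nat := Cantor.of_nat n.

Inductive prog : Type :=
| PZero
| PSucc
| PId
| PFst
| PSnd
| POracle
| PPair (f g : prog)
| PComp (f g : prog)
| PPrim (f g : prog)         (* h <y,0> = f y ; h <y,m+1> = g <y,<m, h <y,m>>> *)
| PMu (f : prog).            (* x |-> least i with f <x,i> = 0 (all earlier defined) *)

(* Oracles are partial: a real answers every query, a finite binary
   string sigma answers only queries below |sigma| (other queries diverge). *)
Definition oracle := nat -> option bool.
Definition real_oracle (X : real) : oracle := fun q => Some (X q).
Definition string_oracle (s : list bool) : oracle := fun q => nth_error s q.
Definition no_oracle : oracle := fun _ => None.

(* Step-indexed evaluation (monotone in the fuel). *)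
Fixpoint eval (fuel : nat) (O : oracle) (p : prog) (x : nat) : option nat :=
  match fuel with
  | 0 => None
  | S k =>
    match p with
    | PZero => Some 0
    | PSucc => Some (S x)
    | PId => Some x
    | PFst => Some (fst (unpair x))
    | PSnd => Some (snd (unpair x))
    | POracle => match O x with
                 | Some b => Some (if b then 1 else 0)
                 | None => None
                 end
    | PPair f g =>
        match eval k O f x, eval k O g x with
        | Some a, Some b => Some (pair a b)
        | _, _ => None
        end
    | PComp f g =>
        match eval k O g x with
        | Some y => eval k O f y
        | None => None
        end
    | PPrim f g =>
        let (y, n) := unpair x in
        match n with
        | 0 => eval k O f y
        | S m =>
            match eval k O (PPrim f g) (pair y m) with
            | Some h => eval k O g (pair y (pair m h))
            | None => None
            end
        end
    | PMu f =>
        (fix search (j i : nat) : option nat :=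
           match j with
           | 0 => None
           | S j' =>
               match eval k O f (pair x i) with
               | Some 0 => Some i
               | Some _ => search j' (S i)
               | None => None
               end
           end) k 0
    end
  end.

Definition converges_to (O : oracle) (p : prog) (n v : nat) : Prop :=
  exists fuel, eval fuel O p n = Some v.

Definition converges (O : oracle) (p : prog) (n : nat) : Prop :=
  exists v, converges_to O p n v.

(* Goedel numbering of programs: tag = n mod 10, children coded by the
   Cantor unpairing of n / 10 (children codes are < n, so fuel n suffices). *)
Fixpoint decode_fuel (fuel n : nat) : prog :=
  match fuel with
  | 0 => PZero
  | S k =>
    let r := n / 10 in
    let (a, b) := unpair r in
    match n mod 10 with
    | 0 => PZero
    | 1 => PSucc
    | 2 => PId
    | 3 => PFst
    | 4 => PSnd
    | 5 => POracle
    | 6 => PPair (decode_fuel k a) (decode_fuel k b)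
    | 7 => PComp (decode_fuel k a) (decode_fuel k b)
    | 8 => PPrim (decode_fuel k a) (decode_fuel k b)
    | _ => PMu (decode_fuel k r)
    end
  end.

Definition decode (e : nat) : prog := decode_fuel (S e) e.

Definition real_of (P : nat -> Prop) : real :=
  fun n => if excluded_middle_informative (P n) then true else false.

Definition jump (Y : real) : real :=
  real_of (fun e => converges (real_oracle Y) (decode e) e).

Definition empty_real : real := fun _ => false.
Definition halting : real := jump empty_real.

Definition join (A B : real) : real :=
  fun n => if Nat.even n then A (Nat.div2 n) else B (Nat.div2 n).

Definition computable (f : nat -> nat) : Prop :=
  exists p : prog, forall n, converges_to no_oracle p n (f n).

Definition tt_reduction (Phi : prog) : Prop :=
  exists f : nat -> nat, computable f /\
    forall n (sigma : list bool), length sigma = f n ->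
      converges (string_oracle sigma) Phi n.

Definition computes (Phi : prog) (B A : real) : Prop :=
  forall n, converges_to (real_oracle B) Phi n (if A n then 1 else 0).

Definition tt_le (A B : real) : Prop :=
  exists Phi : prog, tt_reduction Phi /\ computes Phi B A.

Definition tt_equiv (A B : real) : Prop := tt_le A B /\ tt_le B A.

(* Main.v *)
(** The class of diagonally non-recursive sets is a nonempty Pi-0-1 class, and so is each class
    [P_L = {Y | Phi_e^Y(e) diverges for all e in L}] reached below. In a nonempty Pi-0-1 class [P]
    of such sets, a bit position [k] at which both values still occur can be computed from an index
    of [P]: take a program [k] which, on input [k], waits until one value of the [k]-th bit is seen
    to be excluded from [P], and then outputs the other one. Stage [i] fixes the bit at this
    position to [X(i)], then asks [0'] whether the requirement "[Phi_i^Y(i)] diverges" empties the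
    current class, and imposes it if not. The answer is [Y'(i)]. Unlike in Friedberg's
    construction, where the coding location is found by an unbounded search, all positions and
    queries of the first [i] stages range over a finite set computable from [i], so every
    reduction is a truth-table reduction. *)

From Stdlib Require Import Arith List Bool Lia ClassicalEpsilon.
Require Import Defs.

(** * Evaluation *)

Local Notation fs n := (fst (unpair n)).
Local Notation sn n := (snd (unpair n)).
Local Notation b2n b := (if b then 1 else 0).

Lemma unpair_pair a b : unpair (pair a b) = (a, b).
Proof. apply Cantor.cancel_of_to. Qed.

Lemma fs_pair a b : fs (pair a b) = a.
Proof. now rewrite unpair_pair. Qed.

Lemma sn_pair a b : sn (pair a b) = b.
Proof. now rewrite unpair_pair. Qed.

Lemma pair_unpair n : pair (fs n) (sn n) = n.
Proof. unfold pair, unpair. rewrite <- surjective_pairing. apply Cantor.cancel_to_of. Qed.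

Lemma pair_spec a b : pair a b * 2 = b * 2 + (b + a) * S (b + a).
Proof. apply Cantor.to_nat_spec. Qed.

Lemma pair_mono a b a' b' : a <= a' -> b <= b' -> pair a b <= pair a' b'.
Proof. intros Ha Hb. pose proof (pair_spec a b). pose proof (pair_spec a' b'). nia. Qed.

Lemma fs_le n : fs n <= n.
Proof. pose proof (pair_spec (fs n) (sn n)). rewrite pair_unpair in *. nia. Qed.

Lemma sn_le n : sn n <= n.
Proof. pose proof (pair_spec (fs n) (sn n)). rewrite pair_unpair in *. nia. Qed.

#[local] Opaque pair unpair.

(** A named copy of the loop inside [eval], so that [eval_mu] holds by computation and the loop can
    be reasoned about separately. *)
Definition search (ev : nat -> option nat) : nat -> nat -> option nat :=
  fix search (j i : nat) : option nat :=
    match j with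
    | 0 => None
    | S j' =>
        match ev i with
        | Some 0 => Some i
        | Some _ => search j' (S i)
        | None => None
        end
    end.

Lemma eval_mu k O f x :
  eval (S k) O (PMu f) x = search (fun i => eval k O f (pair x i)) k 0.
Proof. reflexivity. Qed.

Lemma search_spec ev j i v :
  search ev j i = Some v ->
  i <= v /\ ev v = Some 0 /\ forall t, i <= t < v -> exists w, ev t = Some (S w).
Proof.
  revert i; induction j as [|j IH]; intros i; simpl; [discriminate|].
  destruct (ev i) as [[|w]|] eqn:E; intros H; try discriminate.
  - injection H as <-. repeat split; auto. intros; lia.
  - apply IH in H as (H1 & H2 & H3). repeat split; [lia|auto|].
    intros t Ht. destruct (Nat.eq_dec t i) as [->|]; [eauto|]. apply H3; lia.
Qed.

Lemma search_complete ev j i v :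
  ev v = Some 0 -> (forall t, i <= t < v -> exists w, ev t = Some (S w)) ->
  i <= v -> v < i + j -> search ev j i = Some v.
Proof.
  intros H0; revert i; induction j as [|j IH]; intros i H1 H2 H3; [lia|]. simpl.
  destruct (Nat.eq_dec i v) as [->|].
  - now rewrite H0.
  - destruct (H1 i) as [w ->]; [lia|]. apply IH; [|lia|lia].
    intros t Ht; apply H1; lia.
Qed.

Definition extends (O O' : oracle) := forall q b, O q = Some b -> O' q = Some b.

(** Fuel and oracle grow together because every later argument passes between a real and its finite
    parts. Only the [PMu] case is more than a direct induction. *)
Lemma eval_mono k O O' p x v k' :
  extends O O' -> k <= k' -> eval k O p x = Some v -> eval k' O' p x = Some v.
Proof.
  intros HO. revert p x v k'; induction k as [|k IH]; intros p x v k' Hk; [discriminate|].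
  destruct k' as [|k']; [lia|]. apply le_S_n in Hk.
  destruct p; try (simpl; congruence).
  - simpl. destruct (O x) eqn:E; [|discriminate]. now rewrite (HO _ _ E).
  - simpl. destruct (eval k O p1 x) eqn:E1; [|discriminate].
    destruct (eval k O p2 x) eqn:E2; [|discriminate].
    now rewrite (IH _ _ _ k' Hk E1), (IH _ _ _ k' Hk E2).
  - simpl. destruct (eval k O p2 x) eqn:E1; [|discriminate].
    rewrite (IH _ _ _ k' Hk E1). now apply IH.
  - cbn [eval]. destruct (unpair x) as [y [|m]]; [now apply IH|].
    destruct (eval k O (PPrim p1 p2) (pair y m)) eqn:E1; [|discriminate].
    rewrite (IH _ _ _ k' Hk E1). now apply IH.
  - rewrite !eval_mu. intros H.
    (* A search with fuel [k] from 0 tests only arguments below [k], so the larger fuel [k'] still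
       reaches the zero found. *)
    assert (Hv : v < k).
    { clear -H. revert H.
      assert (G : forall ev j i, search ev j i = Some v -> v < i + j).
      { intros ev j; induction j as [|j IHj]; intros i; simpl; [discriminate|].
        destruct (ev i) as [[|w]|]; intros H; try discriminate.
        - injection H as <-. lia.
        - apply IHj in H. lia. }
      intros H; apply G in H. lia. }
    apply search_spec in H as (_ & H0 & H1). apply search_complete; [| |lia|lia].
    + now apply (IH _ _ _ k' Hk).
    + intros t Ht. destruct (H1 t Ht) as [w Hw]. exists w. now apply (IH _ _ _ k' Hk).
Qed.

Lemma extends_refl O : extends O O.
Proof. intros q b H; exact H. Qed.

Lemma converges_mono O O' p x v :
  extends O O' -> converges_to O p x v -> converges_to O' p x v.
Proof. intros HO [k Hk]. exists k. eapply eval_mono; eauto. Qed.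

Lemma converges_unique O p x v w : converges_to O p x v -> converges_to O p x w -> v = w.
Proof.
  intros [k Hk] [l Hl].
  apply (eval_mono _ _ _ _ _ _ (k + l) (extends_refl O)) in Hk; [|lia].
  apply (eval_mono _ _ _ _ _ _ (k + l) (extends_refl O)) in Hl; [|lia].
  congruence.
Qed.

Lemma converges_zero O x : converges_to O PZero x 0.
Proof. now exists 1. Qed.

Lemma converges_succ O x : converges_to O PSucc x (S x).
Proof. now exists 1. Qed.

Lemma converges_id O x : converges_to O PId x x.
Proof. now exists 1. Qed.

Lemma converges_fst O x : converges_to O PFst x (fs x).
Proof. now exists 1. Qed.

Lemma converges_snd O x : converges_to O PSnd x (sn x).
Proof. now exists 1. Qed.

Lemma converges_oracle O x b : O x = Some b -> converges_to O POracle x (b2n b).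
Proof. intros H. exists 1. simpl. now rewrite H. Qed.

Lemma converges_pair O f g x a b :
  converges_to O f x a -> converges_to O g x b -> converges_to O (PPair f g) x (pair a b).
Proof.
  intros [k Hk] [l Hl]. exists (S (k + l)). simpl.
  rewrite (eval_mono _ _ _ _ _ _ (k + l) (extends_refl O) (Nat.le_add_r _ _) Hk).
  now rewrite (eval_mono _ _ _ _ _ _ (k + l) (extends_refl O) (Nat.le_add_l _ _) Hl).
Qed.

Lemma converges_comp O f g x y v :
  converges_to O g x y -> converges_to O f y v -> converges_to O (PComp f g) x v.
Proof.
  intros [k Hk] [l Hl]. exists (S (k + l)). simpl.
  rewrite (eval_mono _ _ _ _ _ _ (k + l) (extends_refl O) (Nat.le_add_r _ _) Hk).
  apply (eval_mono _ _ _ _ _ _ (k + l) (extends_refl O) (Nat.le_add_l _ _) Hl).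
Qed.

Lemma converges_prim0 O f g x v :
  sn x = 0 -> converges_to O f (fs x) v -> converges_to O (PPrim f g) x v.
Proof.
  intros E [k Hk]. exists (S k). cbn [eval].
  destruct (unpair x) as [y n]; simpl in *. now subst.
Qed.

Lemma converges_primS O f g x m h v :
  sn x = S m -> converges_to O (PPrim f g) (pair (fs x) m) h ->
  converges_to O g (pair (fs x) (pair m h)) v -> converges_to O (PPrim f g) x v.
Proof.
  intros E [k Hk] [l Hl]. exists (S (k + l)). cbn [eval].
  destruct (unpair x) as [y n]; simpl in E, Hk, Hl. subst.
  rewrite (eval_mono _ _ _ _ _ _ (k + l) (extends_refl O) (Nat.le_add_r _ _) Hk).
  apply (eval_mono _ _ _ _ _ _ (k + l) (extends_refl O) (Nat.le_add_l _ _) Hl).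
Qed.

Lemma converges_mu O f x i :
  converges_to O f (pair x i) 0 ->
  (forall j, j < i -> exists w, converges_to O f (pair x j) (S w)) ->
  converges_to O (PMu f) x i.
Proof.
  intros [k Hk] H.
  (* The finitely many tests before [i] each have their own fuel; monotonicity merges them into a
     single one. *)
  assert (G : forall i, (forall j, j < i -> exists w, converges_to O f (pair x j) (S w)) ->
     exists l, forall j, j < i -> exists w, eval l O f (pair x j) = Some (S w)).
  { clear. induction i as [|i IH]; intros H; [exists 0; intros; lia|].
    destruct IH as [l Hl]; [intros; apply H; lia|]. destruct (H i) as (w & l' & Hw); [lia|].
    exists (l + l'). intros j Hj. destruct (Nat.eq_dec j i) as [->|].
    - exists w. apply (eval_mono _ _ _ _ _ _ _ (extends_refl O) (Nat.le_add_l _ _) Hw).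
    - destruct (Hl j) as [w' Hw']; [lia|]. exists w'.
      apply (eval_mono _ _ _ _ _ _ _ (extends_refl O) (Nat.le_add_r _ _) Hw'). }
  destruct (G i H) as [l Hl].
  exists (S (k + l + S i)). rewrite eval_mu. apply search_complete; [| |lia|lia].
  - apply (eval_mono k O O); [apply extends_refl|lia|auto].
  - intros t Ht. destruct (Hl t) as [w Hw]; [lia|]. exists w.
    apply (eval_mono l O O); [apply extends_refl|lia|auto].
Qed.

Lemma converges_mu_inv O f x i : converges_to O (PMu f) x i -> converges_to O f (pair x i) 0.
Proof.
  intros [[|k] H]; [discriminate|]. rewrite eval_mu in H.
  apply search_spec in H as (_ & H & _). now exists k.
Qed.

(** Knowing any zero of a total test is enough for the search to halt, by descending to the least
    one. *)
Lemma converges_mu_total O f x (F : nat -> nat) :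
  (forall i, converges_to O f (pair x i) (F i)) ->
  forall i, F i = 0 -> exists j, converges_to O (PMu f) x j /\ F j = 0.
Proof.
  intros H i. induction i as [i IH] using lt_wf_ind; intros Hi.
  destruct (classic (exists j, j < i /\ F j = 0)) as [(j & Hj & E)|N]; [eauto|].
  exists i; split; auto. apply converges_mu; [rewrite <- Hi; apply H|].
  intros j Hj. destruct (F j) as [|w] eqn:E; [exfalso; eauto|].
  exists w. rewrite <- E. apply H.
Qed.

Lemma converges_comp_inv O f g x v :
  converges_to O (PComp f g) x v -> exists y, converges_to O g x y /\ converges_to O f y v.
Proof.
  intros [[|k] H]; [discriminate|]. simpl in H.
  destruct (eval k O g x) as [y|] eqn:E; [|discriminate]. exists y; split; now exists k.
Qed.

(** * Computable functions *)

Lemma extends_no_oracle O : extends no_oracle O.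
Proof. intros q b H; discriminate. Qed.

Lemma computable_ext f g : (forall n, f n = g n) -> computable f -> computable g.
Proof. intros E [p H]. exists p. intros n. rewrite <- E. apply H. Qed.

Lemma computable_app f g : computable f -> computable g -> computable (fun n => f (g n)).
Proof. intros [p Hp] [q Hq]. exists (PComp p q). intros n. eapply converges_comp; eauto. Qed.

Lemma computable_id : computable (fun n => n).
Proof. exists PId. intros; apply converges_id. Qed.

Lemma computable_const k : computable (fun _ => k).
Proof.
  induction k as [|k [p Hp]].
  - exists PZero. intros; apply converges_zero.
  - exists (PComp PSucc p). intros n. eapply converges_comp; [apply Hp|apply converges_succ].
Qed.

Lemma computable_S g : computable g -> computable (fun n => S (g n)).
Proof. apply (computable_app S). exists PSucc. intros; apply converges_succ. Qed.

Lemma computable_fs g : computable g -> computable (fun n => fs (g n)).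
Proof. apply (computable_app (fun n => fs n)). exists PFst. intros; apply converges_fst. Qed.

Lemma computable_sn g : computable g -> computable (fun n => sn (g n)).
Proof. apply (computable_app (fun n => sn n)). exists PSnd. intros; apply converges_snd. Qed.

Lemma computable_pair f g : computable f -> computable g -> computable (fun n => pair (f n) (g n)).
Proof. intros [p Hp] [q Hq]. exists (PPair p q). intros n. apply converges_pair; auto. Qed.

Definition rec (a : nat) (g : nat -> nat -> nat) (n : nat) : nat := nat_rect (fun _ => nat) a g n.

(** The step program is only required to converge on the values that the recursion actually reaches.
    This matters for oracles that answer finitely many queries, as in [tt_functional_rec]. *)
Lemma converges_prim O p q x (a : nat) (g : nat -> nat -> nat) :
  converges_to O p (fs x) a ->
  (forall m, m < sn x -> let h := rec a g m in converges_to O q (pair (fs x) (pair m h)) (g m h)) ->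
  converges_to O (PPrim p q) x (rec a g (sn x)).
Proof.
  intros Ha Hg. remember (sn x) as n eqn:En.
  rewrite <- (pair_unpair x), <- En.
  set (y := fs x) in *. clearbody y. clear x En.
  induction n as [|n IH].
  - apply converges_prim0; rewrite unpair_pair; auto.
  - eapply converges_primS; rewrite ?unpair_pair; simpl; [reflexivity|apply IH; intros; apply Hg; lia|].
    apply Hg; lia.
Qed.

Lemma computable_rec f (g : nat -> nat -> nat -> nat) t :
  computable f -> computable (fun z => g (fs z) (fs (sn z)) (sn (sn z))) -> computable t ->
  computable (fun n => rec (f n) (g n) (t n)).
Proof.
  intros [p Hp] [q Hq] Ht.
  apply (computable_ext (fun n => (fun x => rec (f (fs x)) (g (fs x)) (sn x)) (pair n (t n)))).
  { intros n. now rewrite unpair_pair. }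
  apply (computable_app (fun x => rec (f (fs x)) (g (fs x)) (sn x)));
    [|apply computable_pair; auto using computable_id].
  exists (PPrim p q). intros x. apply converges_prim; [apply Hp|].
  intros m _ h. specialize (Hq (pair (fs x) (pair m h))). now rewrite !sn_pair, !fs_pair in Hq.
Qed.

Lemma computable_app2 (f : nat -> nat -> nat) g h :
  computable (fun z => f (fs z) (sn z)) -> computable g -> computable h ->
  computable (fun n => f (g n) (h n)).
Proof.
  intros Hf Hg Hh.
  apply (computable_ext (fun n => (fun z => f (fs z) (sn z)) (pair (g n) (h n)))).
  { intros n. now rewrite fs_pair, sn_pair. }
  apply (computable_app (fun z => f (fs z) (sn z))); auto using computable_pair.
Qed.

(* Closure of the computable functions under arithmetic *)
Create HintDb comp.
(** Follows the syntax of the function body. Closure lemmas are registered in the database [comp] as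
    they are proved, and each hint calls [comp] again on the arguments. *)
Ltac comp :=
  cbv beta;
  lazymatch goal with
  | |- computable (fun n => n) => apply computable_id
  | |- computable (fun _ => ?k) => apply (computable_const k)
  | |- computable (fun n => S _) => apply computable_S; comp
  | |- computable (fun n => fst (unpair _)) => apply computable_fs; comp
  | |- computable (fun n => snd (unpair _)) => apply computable_sn; comp
  | |- computable (fun n => pair _ _) => apply computable_pair; comp
  | |- computable (fun n => ?f (@?g n) (@?h n)) =>
      first [assumption | solve [auto 1 with nocore comp]
            | apply (computable_app2 f g h); [first [assumption | solve [auto 1 with nocore comp]] | comp | comp]]
  | |- computable (fun n => ?f (@?g n)) =>
      first [assumption | solve [auto 1 with nocore comp]
            | apply (computable_app f g); [first [assumption | solve [auto 1 with nocore comp]] | comp]]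
  | |- computable _ => first [assumption | solve [auto 1 with nocore comp]]
  | |- _ => idtac
  end.

(** Zero plays the part of true, in agreement with the test of [PMu]. *)
Definition ifz (t a b : nat) : nat := match t with 0 => a | S _ => b end.

Lemma computable_ifz t a b :
  computable t -> computable a -> computable b -> computable (fun n => ifz (t n) (a n) (b n)).
Proof.
  intros Ht Ha Hb.
  apply (computable_ext (fun n => rec (a n) (fun _ _ => b n) (t n))).
  { intros n. now destruct (t n). }
  apply (computable_rec a (fun n _ _ => b n) t); auto. comp.
Qed.
#[local] Hint Extern 1 (computable (fun n => ifz _ _ _)) => apply computable_ifz; comp : comp.

Lemma computable_pred t : computable t -> computable (fun n => pred (t n)).
Proof.
  intros Ht. apply (computable_ext (fun n => rec 0 (fun m _ => m) (t n))).
  { intros n. now destruct (t n). }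
  apply (computable_rec (fun _ => 0) (fun _ m _ => m) t); comp.
Qed.
#[local] Hint Extern 1 (computable (fun n => pred _)) => apply computable_pred; comp : comp.

Lemma computable_add f g : computable f -> computable g -> computable (fun n => f n + g n).
Proof.
  intros Hf Hg. apply (computable_ext (fun n => rec (f n) (fun _ h => S h) (g n))).
  { intros n. induction (g n) as [|k IH]; simpl; [lia|]. rewrite IH; lia. }
  apply (computable_rec f (fun _ _ h => S h) g); comp.
Qed.
#[local] Hint Extern 1 (computable (fun n => _ + _)) => apply computable_add; comp : comp.

Lemma computable_sub f g : computable f -> computable g -> computable (fun n => f n - g n).
Proof.
  intros Hf Hg. apply (computable_ext (fun n => rec (f n) (fun _ h => pred h) (g n))).
  { intros n. induction (g n) as [|k IH]; simpl; [lia|]. rewrite IH; lia. }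
  apply (computable_rec f (fun _ _ h => pred h) g); comp.
Qed.
#[local] Hint Extern 1 (computable (fun n => _ - _)) => apply computable_sub; comp : comp.

Lemma computable_mul f g : computable f -> computable g -> computable (fun n => f n * g n).
Proof.
  intros Hf Hg. apply (computable_ext (fun n => rec 0 (fun _ h => h + f n) (g n))).
  { intros n. induction (g n) as [|k IH]; simpl; [lia|]. rewrite IH; lia. }
  apply (computable_rec (fun _ => 0) (fun n _ h => h + f n) g); comp.
Qed.
#[local] Hint Extern 1 (computable (fun n => _ * _)) => apply computable_mul; comp : comp.

Lemma computable_pow f g : computable f -> computable g -> computable (fun n => f n ^ g n).
Proof.
  intros Hf Hg. apply (computable_ext (fun n => rec 1 (fun _ h => f n * h) (g n))).
  { intros n. induction (g n) as [|k IH]; simpl; [lia|]. rewrite IH; lia. }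
  apply (computable_rec (fun _ => 1) (fun n _ h => f n * h) g); comp.
Qed.
#[local] Hint Extern 1 (computable (fun n => _ ^ _)) => apply computable_pow; comp : comp.

(** Serves as a bounded universal quantifier ([sum_zero]) and as a computable upper bound for all
    the terms ([sum_ge]). *)
Definition sum (n : nat) (f : nat -> nat) : nat := rec 0 (fun i h => h + f i) n.

Lemma computable_sum (f : nat -> nat -> nat) t :
  computable t -> computable (fun z => f (fs z) (sn z)) ->
  computable (fun n => sum (t n) (f n)).
Proof.
  intros Ht Hf. apply (computable_rec (fun _ => 0) (fun n i h => h + f n i) t); comp.
Qed.
#[local] Hint Extern 1 (computable (fun n => sum _ _)) => apply computable_sum; comp : comp.

Lemma sum_zero n f : sum n f = 0 <-> forall i, i < n -> f i = 0.
Proof.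
  unfold sum. induction n as [|n IH]; simpl; [split; auto; intros; lia|]. split.
  - intros H i Hi. destruct (Nat.eq_dec i n) as [->|]; [lia|]. apply IH; lia.
  - intros H. rewrite (proj2 IH), H; auto.
Qed.

Lemma sum_ge n f i : i < n -> f i <= sum n f.
Proof.
  unfold sum. induction n as [|n IH]; simpl; [lia|]. intros Hi.
  destruct (Nat.eq_dec i n) as [->|]; [lia|]. specialize (IH ltac:(lia)). lia.
Qed.

Lemma computable_div f g :
  (forall n, g n <> 0) -> computable f -> computable g -> computable (fun n => f n / g n).
Proof.
  intros Hn Hf Hg.
  (* The quotient counts the positive multiples of the divisor that do not exceed the dividend; as
     the quotient is at most the dividend, testing that many multiples suffices. *)
  apply (computable_ext (fun n => sum (f n) (fun i => ifz (S i * g n - f n) 1 0))).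
  { intros n. specialize (Hn n). set (a := f n) in *. set (b := g n) in *. clearbody a b.
    assert (G : forall k, sum k (fun i => ifz (S i * b - a) 1 0) = Nat.min k (a / b)).
    { intros k; unfold sum; induction k as [|k IH]; [reflexivity|].
      change (rec 0 (fun i h => h + ifz (S i * b - a) 1 0) k + ifz (S k * b - a) 1 0
        = Nat.min (S k) (a / b)).
      rewrite IH. destruct (S k * b - a) eqn:E; unfold ifz.
      - assert (S k <= a / b) by (apply Nat.div_le_lower_bound; lia). lia.
      - assert (a / b < S k) by (apply Nat.Div0.div_lt_upper_bound; lia). lia. }
    rewrite G. apply Nat.min_r. apply Nat.Div0.div_le_upper_bound. nia. }
  apply (computable_sum (fun n i => ifz (S i * g n - f n) 1 0)); comp.
Qed.

Lemma computable_mod f g :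
  (forall n, g n <> 0) -> computable f -> computable g -> computable (fun n => f n mod g n).
Proof.
  intros Hn Hf Hg. apply (computable_ext (fun n => f n - g n * (f n / g n))).
  { intros n. now rewrite Nat.Div0.mod_eq. }
  auto using computable_sub, computable_mul, computable_div.
Qed.
#[local] Hint Extern 1 (computable (fun n => _ / _)) => apply computable_div; [lia | comp | comp] : comp.
#[local] Hint Extern 1 (computable (fun n => _ mod _)) => apply computable_mod; [lia | comp | comp] : comp.

Lemma computable_testbit f g :
  computable f -> computable g -> computable (fun n => b2n (Nat.testbit (f n) (g n))).
Proof.
  intros Hf Hg. apply (computable_ext (fun n => (f n / 2 ^ g n) mod 2)).
  { intros n. rewrite <- Nat.testbit_spec'. now destruct (Nat.testbit _ _). }
  apply computable_mod; [lia| |comp]. apply computable_div; [|comp|comp].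
  intros n. apply Nat.pow_nonzero; lia.
Qed.
#[local] Hint Extern 1 (computable (fun n => if Nat.testbit _ _ then 1 else 0)) =>
  apply computable_testbit; comp : comp.

(** * Program codes *)

(** The codes of the children of a nonzero [n] are at most [n / 10 < n], so any fuel above the code
    gives the same program. *)
Lemma decode_fuel_irrel k l n : n < k -> n < l -> decode_fuel k n = decode_fuel l n.
Proof.
  revert l n; induction k as [|k IH]; intros l n Hk Hl; [lia|]. destruct l as [|l]; [lia|].
  cbn [decode_fuel]. pose proof (fs_le (n / 10)). pose proof (sn_le (n / 10)).
  destruct (unpair (n / 10)) as [a b] eqn:E; cbn [fst snd] in *.
  destruct (Nat.eq_dec n 0) as [->|Hn]; [reflexivity|].
  assert (n / 10 < n) by (apply Nat.div_lt; lia).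
  rewrite (IH l a), (IH l b), (IH l (n / 10)) by lia. reflexivity.
Qed.

Lemma decode_eq n :
  decode n =
    let r := n / 10 in
    match n mod 10 with
    | 0 => PZero
    | 1 => PSucc
    | 2 => PId
    | 3 => PFst
    | 4 => PSnd
    | 5 => POracle
    | 6 => PPair (decode (fs r)) (decode (sn r))
    | 7 => PComp (decode (fs r)) (decode (sn r))
    | 8 => PPrim (decode (fs r)) (decode (sn r))
    | _ => PMu (decode r)
    end.
Proof.
  unfold decode at 1. cbn [decode_fuel]. pose proof (fs_le (n / 10)). pose proof (sn_le (n / 10)).
  destruct (unpair (n / 10)) as [a b] eqn:E; cbn [fst snd] in *.
  destruct (Nat.eq_dec n 0) as [->|Hn]; [reflexivity|].
  assert (n / 10 < n) by (apply Nat.div_lt; lia). unfold decode.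
  rewrite (decode_fuel_irrel n (S a) a), (decode_fuel_irrel n (S b) b),
    (decode_fuel_irrel n (S (n / 10)) (n / 10)) by lia. reflexivity.
Qed.

Definition tagged (t r : nat) : nat := t + r * 10.

Lemma tagged_mod t r : t < 10 -> tagged t r mod 10 = t.
Proof. intros H. unfold tagged. rewrite Nat.Div0.mod_add. now apply Nat.mod_small. Qed.

Lemma tagged_div t r : t < 10 -> tagged t r / 10 = r.
Proof. intros H. unfold tagged. rewrite Nat.div_add by lia. now rewrite Nat.div_small. Qed.

Fixpoint encode (p : prog) : nat :=
  match p with
  | PZero => tagged 0 0
  | PSucc => tagged 1 0
  | PId => tagged 2 0
  | PFst => tagged 3 0
  | PSnd => tagged 4 0
  | POracle => tagged 5 0
  | PPair f g => tagged 6 (pair (encode f) (encode g))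
  | PComp f g => tagged 7 (pair (encode f) (encode g))
  | PPrim f g => tagged 8 (pair (encode f) (encode g))
  | PMu f => tagged 9 (encode f)
  end.

Lemma decode_encode p : decode (encode p) = p.
Proof.
  induction p; cbn [encode]; rewrite decode_eq, tagged_mod, tagged_div by lia; cbn zeta;
    rewrite ?fs_pair, ?sn_pair; congruence.
Qed.

(** * The s-m-n theorem *)

Fixpoint pconst (w : nat) : prog :=
  match w with 0 => PZero | S w => PComp PSucc (pconst w) end.

Lemma converges_pconst O w x : converges_to O (pconst w) x w.
Proof. induction w; [apply converges_zero|]. eapply converges_comp; [eassumption|apply converges_succ]. Qed.

Lemma computable_encode_pconst : computable (fun w => encode (pconst w)).
Proof.
  apply (computable_ext (fun w => rec (encode PZero) (fun _ h => tagged 7 (pair (encode PSucc) h)) w)).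
  { intros w. induction w as [|w IH]; [reflexivity|]. cbn [pconst encode]. now rewrite <- IH. }
  apply (computable_rec (fun _ => encode PZero) (fun _ _ h => tagged 7 (pair (encode PSucc) h)) (fun w => w));
    unfold tagged; comp.
Qed.

(** The parameter is put in the second component. Run on its own code, as in [jump], the program
    [smn p w] thus receives that code as first component, which gives self-reference without the
    recursion theorem. *)
Definition smn (p : prog) (w : nat) : nat := encode (PComp p (PPair PId (pconst w))).

Lemma computable_smn p : computable (smn p).
Proof.
  unfold smn. cbn [encode]. unfold tagged. pose proof computable_encode_pconst. comp.
Qed.

Lemma converges_smn O p w x v :
  converges_to O (decode (smn p w)) x v <-> converges_to O p (pair x w) v.
Proof.
  unfold smn. rewrite decode_encode. split.
  - intros H. apply converges_comp_inv in H as (y & H1 & H2).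
    assert (H3 : converges_to O (PPair PId (pconst w)) x (pair x w))
      by (apply converges_pair; [apply converges_id|apply converges_pconst]).
    now rewrite (converges_unique _ _ _ _ _ H1 H3) in H2.
  - intros H. eapply converges_comp; [apply converges_pair; [apply converges_id|apply converges_pconst]|exact H].
Qed.

(** * A stack machine evaluating coded programs *)

(* State [St m v K]: with [m = 0] the value [v] is returned to the stack [K];
   with [m = S e] the program coded by [e] is started on [v]. *)
Definition St (m v K : nat) : nat := pair m (pair v K).
Definition push (t c d K : nat) : nat := S (pair (pair t (pair c d)) K).

(** The stack 0 is empty and halts the machine. Frames by tag: 0 applies [c] to the value; 1 starts
    the second half [c] of a pair on [d]; 2 pairs the stored value [c] with the new one; 3 runs the
    recursion step [c] with [d] coding the parameter and counter; 4 is a search testing [c], with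
    [d] coding the input and the current candidate. *)
Definition return_step (v K s : nat) : nat :=
  let t := fs (fs (pred K)) in
  let c := fs (sn (fs (pred K))) in
  let d := sn (sn (fs (pred K))) in
  let K' := sn (pred K) in
  ifz K s
  (ifz t (St (S c) v K')
  (ifz (t - 1) (St (S c) d (push 2 v 0 K'))
  (ifz (t - 2) (St 0 (pair c v) K')
  (ifz (t - 3) (St (S c) (pair (fs d) (pair (sn d) v)) K')
  (ifz v (St 0 (sn d) K')
     (St (S c) (pair (fs d) (S (sn d))) (push 4 c (pair (fs d) (S (sn d))) K'))))))).

Definition start_step (o : nat -> nat) (e x K s : nat) : nat :=
  let t := e mod 10 in
  let r := e / 10 in
  ifz t (St 0 0 K)
  (ifz (t - 1) (St 0 (S x) K)
  (ifz (t - 2) (St 0 x K)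
  (ifz (t - 3) (St 0 (fs x) K)
  (ifz (t - 4) (St 0 (sn x) K)
  (ifz (t - 5) (ifz (o x) s (St 0 (pred (o x)) K))
  (ifz (t - 6) (St (S (fs r)) x (push 1 (sn r) x K))
  (ifz (t - 7) (St (S (sn r)) x (push 0 (fs r) 0 K))
  (ifz (t - 8) (ifz (sn x) (St (S (fs r)) (fs x) K)
                  (St (S e) (pair (fs x) (pred (sn x)))
                     (push 3 (sn r) (pair (fs x) (pred (sn x))) K)))
  (St (S r) (pair x 0) (push 4 r (pair x 0) K)))))))))).

(** Answers are shifted by one, so that 0 marks an unanswered query; at such a query [start_step]
    repeats the state forever. *)
Definition answer (O : oracle) (x : nat) : nat :=
  match O x with None => 0 | Some b => S (b2n b) end.

Definition step (o : nat -> nat) (s : nat) : nat :=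
  ifz (fs s) (return_step (fs (sn s)) (sn (sn s)) s)
    (start_step o (pred (fs s)) (fs (sn s)) (sn (sn s)) s).

Definition steps (o : nat -> nat) (n s : nat) : nat := Nat.iter n (step o) s.

(** * Correctness of the stack machine *)

Lemma steps_S o n s : steps o (S n) s = steps o n (step o s).
Proof. apply Nat.iter_succ_r. Qed.

Lemma steps_add o n m s : steps o (n + m) s = steps o m (steps o n s).
Proof. unfold steps. rewrite Nat.add_comm. apply Nat.iter_add. Qed.

Lemma St_inj m v K m' v' K' : St m v K = St m' v' K' -> m = m' /\ v = v' /\ K = K'.
Proof.
  intros H. pose proof (f_equal unpair H) as E. unfold St in E. rewrite !unpair_pair in E.
  injection E as -> E. apply (f_equal unpair) in E. rewrite !unpair_pair in E.
  injection E as -> ->. auto.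
Qed.

Lemma St_push_neq v t c d K v' : St 0 v (push t c d K) <> St 0 v' 0.
Proof. intros H. apply St_inj in H as (_ & _ & H). discriminate. Qed.

Lemma step_return o v K : step o (St 0 v K) = return_step v K (St 0 v K).
Proof. unfold step, St. now rewrite fs_pair, !sn_pair, fs_pair. Qed.

Lemma step_start o e x K : step o (St (S e) x K) = start_step o e x K (St (S e) x K).
Proof. unfold step, St. now rewrite fs_pair, !sn_pair, fs_pair. Qed.

Lemma step_push o v t c d K :
  step o (St 0 v (push t c d K)) =
  (ifz t (St (S c) v K)
  (ifz (t - 1) (St (S c) d (push 2 v 0 K))
  (ifz (t - 2) (St 0 (pair c v) K)
  (ifz (t - 3) (St (S c) (pair (fs d) (pair (sn d) v)) K)
  (ifz v (St 0 (sn d) K)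
     (St (S c) (pair (fs d) (S (sn d))) (push 4 c (pair (fs d) (S (sn d))) K))))))).
Proof.
  rewrite step_return. unfold return_step.
  assert (E : pred (push t c d K) = pair (pair t (pair c d)) K) by reflexivity.
  rewrite E. repeat rewrite ?fs_pair, ?sn_pair. reflexivity.
Qed.

Ltac start_by E := rewrite step_start; unfold start_step; rewrite E; cbn [ifz Nat.sub].

Ltac machine :=
  repeat rewrite ?steps_add, ?steps_S, ?step_push;
  cbn [ifz Nat.sub]; rewrite ?fs_pair, ?sn_pair.

(** The number of steps is uniform in the stack [K]; this is what allows the runs of subprograms to
    be spliced together. *)
Lemma machine_complete O k e x v :
  eval k O (decode e) x = Some v ->
  exists n, forall K, steps (answer O) n (St (S e) x K) = St 0 v K.
Proof.
  set (o := answer O).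
  revert e x v; induction k as [|k IH]; intros e x v; [discriminate|].
  rewrite decode_eq. cbn zeta.
  destruct (e mod 10) as [|[|[|[|[|[|[|[|[|t]]]]]]]]] eqn:E; intros H.
  1-5: injection H as <-; exists 1; intros K; rewrite steps_S; start_by E; reflexivity.
  - simpl in H. destruct (O x) as [b|] eqn:Eb; [|discriminate]. injection H as <-.
    exists 1; intros K; rewrite steps_S; start_by E. unfold o, answer. now rewrite Eb.
  - cbn [eval] in H.
    destruct (eval k O (decode (fs (e / 10))) x) as [a|] eqn:E1; [|discriminate].
    destruct (eval k O (decode (sn (e / 10))) x) as [b|] eqn:E2; [|discriminate].
    injection H as <-. apply IH in E1 as [n1 H1], E2 as [n2 H2].
    exists (S (n1 + S (n2 + 1))). intros K. rewrite steps_S. start_by E.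
    rewrite steps_add, H1. machine. rewrite H2. machine. reflexivity.
  - cbn [eval] in H.
    destruct (eval k O (decode (sn (e / 10))) x) as [a|] eqn:E1; [|discriminate].
    apply IH in E1 as [n1 H1], H as [n2 H2].
    exists (S (n1 + S n2)). intros K. rewrite steps_S. start_by E.
    rewrite steps_add, H1. machine. now rewrite H2.
  - cbn [eval] in H. pose proof (pair_unpair x) as Ex.
    destruct (unpair x) as [y [|m]] eqn:Eu; cbn [fst snd] in *.
    + apply IH in H as [n H]. exists (S n). intros K. rewrite steps_S. start_by E.
      rewrite Eu. cbn [fst snd ifz]. apply H.
    + destruct (eval k O _ (pair y m)) as [h|] eqn:E1 in H; [|discriminate].
      (* The recursive call of [PPrim] restarts the same code [e] with a smaller counter, so the
         induction hypothesis on fuel is applied to [e] itself. *)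
      assert (E3 : eval k O (decode e) (pair y m) = Some h)
        by (rewrite decode_eq; cbn zeta; rewrite E; exact E1).
      apply IH in E3 as [n1 H1], H as [n2 H2].
      exists (S (n1 + S n2)). intros K. rewrite steps_S. start_by E.
      rewrite Eu. cbn [fst snd ifz pred]. rewrite steps_add, H1. machine. now rewrite H2.
  - set (r := e / 10) in *. rewrite eval_mu in H. apply search_spec in H as (_ & H0 & H1).
    assert (G : forall j, j <= v -> exists n, forall K,
      steps o n (St (S r) (pair x 0) (push 4 r (pair x 0) K)) =
      St (S r) (pair x j) (push 4 r (pair x j) K)).
    { induction j as [|j IHj]; intros Hj; [exists 0; reflexivity|].
      destruct IHj as [n Hn]; [lia|]. destruct (H1 j) as [w Hw]; [lia|].
      apply IH in Hw as [n' Hw]. exists (n + (n' + 1)). intros K.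
      rewrite !steps_add, Hn, Hw. machine. reflexivity. }
    destruct (G v (le_n v)) as [n Hn]. apply IH in H0 as [n' H0].
    exists (S (n + (n' + 1))). intros K. rewrite steps_S. start_by E. fold r.
    rewrite !steps_add, Hn, H0. machine. reflexivity.
Qed.

(** A run that ends with the empty stack must first return a value to the stack [K] it started on.
    The strict bound [m < n] leaves a shorter run, to which the induction applies again for the next
    subprogram. *)
Lemma machine_sound O n e x K v' :
  steps (answer O) n (St (S e) x K) = St 0 v' 0 ->
  exists v m, m < n /\ converges_to O (decode e) x v /\ steps (answer O) m (St 0 v K) = St 0 v' 0.
Proof.
  set (o := answer O).
  revert e x K; induction n as [n IH] using lt_wf_ind; intros e x K H.
  destruct n as [|n]; [now apply St_inj in H as [H _]|].
  assert (H' := H). rewrite steps_S in H. revert H. rewrite decode_eq. cbn zeta.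
  destruct (e mod 10) as [|[|[|[|[|[|[|[|[|t]]]]]]]]] eqn:E; start_by E; intros H.
  1-5: eexists _, n; split; [lia|]; split; [|exact H].
  + apply converges_zero.
  + apply converges_succ.
  + apply converges_id.
  + apply converges_fst.
  + apply converges_snd.
  + unfold o, answer in H. destruct (O x) as [b|] eqn:Eb; cbn [ifz pred] in H.
    * exists (b2n b), n. split; [lia|]. split; [now apply converges_oracle|exact H].
    (* An unanswered query repeats the state, so the same state reaches the end in one step
       fewer. *)
    * destruct (IH n (Nat.lt_succ_diag_r n) e x K H) as (v & m & Hm & Hv & Hs).
      exists v, m. split; [lia|]. split; auto.
      rewrite decode_eq in Hv. cbn zeta in Hv. now rewrite E in Hv.
  + apply IH in H as (a & m & Hm & Ha & H); [|lia]. destruct m as [|m].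
    { now apply St_push_neq in H. }
    revert H. machine. intros H.
    apply IH in H as (b & m' & Hm' & Hb & H); [|lia]. destruct m' as [|m'].
    { now apply St_push_neq in H. }
    revert H. machine. intros H.
    exists (pair a b), m'. split; [lia|]. split; [now apply converges_pair|exact H].
  + apply IH in H as (a & m & Hm & Ha & H); [|lia]. destruct m as [|m].
    { now apply St_push_neq in H. }
    revert H. machine. intros H.
    apply IH in H as (b & m' & Hm' & Hb & H); [|lia].
    exists b, m'. split; [lia|]. split; [eapply converges_comp; eauto|exact H].
  + destruct (sn x) as [|y] eqn:Ex; cbn [ifz pred] in H.
    * apply IH in H as (a & m & Hm & Ha & H); [|lia].
      exists a, m. split; [lia|]. split; [now apply converges_prim0|exact H].
    * apply IH in H as (a & m & Hm & Ha & H); [|lia]. destruct m as [|m].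
      { now apply St_push_neq in H. }
      revert H. machine. intros H.
      apply IH in H as (b & m' & Hm' & Hb & H); [|lia].
      exists b, m'. split; [lia|]. split; [|exact H].
      eapply converges_primS; [exact Ex| |exact Hb].
      rewrite decode_eq in Ha. cbn zeta in Ha. now rewrite E in Ha.
  + set (r := e / 10) in *.
    (* An inner induction on the remaining steps follows the search loop, recording that all earlier
       candidates gave nonzero values. *)
    assert (G : forall n', n' <= n -> forall i,
      (forall j, j < i -> exists w, converges_to O (decode r) (pair x j) (S w)) ->
      steps o n' (St (S r) (pair x i) (push 4 r (pair x i) K)) = St 0 v' 0 ->
      exists v m, m < S n /\ converges_to O (PMu (decode r)) x v /\ steps o m (St 0 v K) = St 0 v' 0).
    { induction n' as [n' IHn] using lt_wf_ind; intros Hn' i Hi Hs.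
      apply IH in Hs as (a & m & Hm & Ha & Hs); [|lia]. destruct m as [|m].
      { now apply St_push_neq in Hs. }
      revert Hs. machine. destruct a as [|a]; cbn [ifz]; intros Hs.
      - exists i, m. split; [lia|]. split; [now apply converges_mu|exact Hs].
      - apply (IHn m) with (i := S i); [lia|lia| |exact Hs].
        intros j Hj. destruct (Nat.eq_dec j i) as [->|]; [eauto|]. apply Hi; lia. }
    apply (G n (le_n n) 0); [intros; lia|exact H].
Qed.

(** * Finite use and bounded runs *)

Lemma step_local o o' s : o (fs (sn s)) = o' (fs (sn s)) -> step o s = step o' s.
Proof. intros H. unfold step, start_step. now rewrite H. Qed.

(** The only possible query is at the current value. If it is unanswered, either the step does not
    consult the oracle or the machine loops in a running state and never halts. *)
Lemma step_stuck o o' s : o (fs (sn s)) = 0 -> step o s = step o' s \/ step o s = s /\ fs s <> 0.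
Proof.
  intros H. unfold step. destruct (fs s) as [|e]; [now left|]. cbn [ifz pred].
  unfold start_step. rewrite H. cbn [ifz].
  destruct (e mod 10) as [|[|[|[|[|[|[|[|[|t]]]]]]]]]; cbn [ifz Nat.sub]; auto.
Qed.

Lemma steps_halted o n v : steps o n (St 0 v 0) = St 0 v 0.
Proof. induction n; [reflexivity|]. rewrite steps_S, step_return. exact IHn. Qed.

Lemma steps_stuck o n s : step o s = s -> steps o n s = s.
Proof. intros H. induction n; [reflexivity|]. now rewrite steps_S, H. Qed.

Lemma steps_mono O O' n s v :
  extends O O' -> steps (answer O) n s = St 0 v 0 -> steps (answer O') n s = St 0 v 0.
Proof.
  intros HO. revert s; induction n as [|n IH]; intros s H; [exact H|].
  destruct (O (fs (sn s))) as [b|] eqn:E.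
  - rewrite steps_S in *. rewrite <- (step_local (answer O)); [auto|].
    unfold answer. now rewrite E, (HO _ _ E).
  - destruct (step_stuck (answer O) (answer O') s) as [Es|[Es Hs]].
    + unfold answer. now rewrite E.
    + rewrite steps_S in *. rewrite <- Es. auto.
    + rewrite steps_stuck in H by exact Es. exfalso. apply Hs. rewrite H. apply fs_pair.
Qed.

Definition trunc (Y : real) (l : nat) : oracle := fun q => if q <? l then Some (Y q) else None.

Lemma trunc_extends Y l l' : l <= l' -> extends (trunc Y l) (trunc Y l').
Proof.
  intros Hl q b. unfold trunc. destruct (Nat.ltb_spec q l); [|discriminate].
  destruct (Nat.ltb_spec q l'); [auto|lia].
Qed.

Lemma trunc_extends_real Y l : extends (trunc Y l) (real_oracle Y).
Proof. intros q b. unfold trunc, real_oracle. destruct (q <? l); congruence. Qed.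

Lemma steps_use Y n s :
  exists l0, forall l, l0 <= l -> steps (answer (trunc Y l)) n s = steps (answer (real_oracle Y)) n s.
Proof.
  revert s; induction n as [|n IH]; intros s; [now exists 0|].
  destruct (IH (step (answer (real_oracle Y)) s)) as [l0 H].
  exists (l0 + S (fs (sn s))). intros l Hl. rewrite !steps_S, <- (H l) by lia. f_equal.
  apply step_local. unfold answer, trunc, real_oracle.
  destruct (Nat.ltb_spec (fs (sn s)) l); [reflexivity|lia].
Qed.

(** Shifted by one: 0 means that the state is not halted, [S v] that it is halted with value [v]. *)
Definition outcome (s : nat) : nat := ifz (fs s) (ifz (sn (sn s)) (S (fs (sn s))) 0) 0.

Lemma outcome_S s v : outcome s = S v <-> s = St 0 v 0.
Proof.
  unfold outcome. split.
  - destruct (fs s) eqn:E; [|discriminate]. destruct (sn (sn s)) eqn:E'; [|discriminate].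
    cbn [ifz]. intros H. injection H as <-. unfold St.
    
    rewrite <- (pair_unpair s) at 1. rewrite E. f_equal.
    rewrite <- (pair_unpair (sn s)) at 1. now rewrite E'.
  - intros ->. unfold St. now rewrite fs_pair, !sn_pair, fs_pair.
Qed.

(* [run Y l e] is [S v] if the [e]-th program on input [e] returns [v] within [l] machine
   steps, querying only [Y] below [l]; otherwise it is [0]. *)
Definition run (Y : real) (l e : nat) : nat :=
  outcome (steps (answer (trunc Y l)) l (St (S e) e 0)).

Lemma run_mono Y l l' e v : l <= l' -> run Y l e = S v -> run Y l' e = S v.
Proof.
  unfold run. rewrite !outcome_S. intros Hl H.
  apply (steps_mono _ _ _ _ _ (trunc_extends Y l l' Hl)) in H.
  replace l' with (l + (l' - l)) at 2 by lia. now rewrite steps_add, H, steps_halted.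
Qed.

Lemma run_converges Y e v :
  converges_to (real_oracle Y) (decode e) e v <-> exists l, run Y l e = S v.
Proof.
  split.
  - intros [k H]. apply machine_complete in H as [n H].
    (* The sum bounds both the length of the run and its queries; steps after halting change
       nothing. *)
    destruct (steps_use Y n (St (S e) e 0)) as [l0 Hl]. exists (n + l0).
    unfold run. apply outcome_S.
    rewrite steps_add, (Hl (n + l0)), H by lia. apply steps_halted.
  - intros [l H]. apply outcome_S, machine_sound in H as (v' & m & _ & Hv & H).
    rewrite steps_halted in H. apply St_inj in H as (_ & -> & _).
    exact (converges_mono _ _ _ _ _ (trunc_extends_real Y l) Hv).
Qed.

Lemma run_agree Y Z l e : (forall q, q < l -> Y q = Z q) -> run Y l e = run Z l e.
Proof.
  intros H. unfold run. f_equal.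
  assert (G : forall n s, steps (answer (trunc Y l)) n s = steps (answer (trunc Z l)) n s).
  { induction n as [|n IH]; intros s; [reflexivity|]. rewrite !steps_S, IH. f_equal.
    apply step_local. unfold answer, trunc.
    destruct (Nat.ltb_spec (fs (sn s)) l); [now rewrite H|reflexivity]. }
  apply G.
Qed.

(** A finite oracle prefix is given by the binary digits of a number, which turns bounded runs into
    an arithmetical function. *)
Lemma computable_run c l e :
  computable c -> computable l -> computable e ->
  computable (fun n => run (Nat.testbit (c n)) (l n) (e n)).
Proof.
  intros Hc Hl He.
  (* The difference [S x - l n] vanishes exactly when [x < l n], that is, when the truncated oracle
     answers. *)
  set (o := fun n x => ifz (S x - l n) (S (b2n (Nat.testbit (c n) x))) 0).
  apply (computable_ext (fun n => outcome (rec (St (S (e n)) (e n) 0) (fun _ s => step (o n) s) (l n)))).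
  { intros n. unfold run. f_equal.
    set (o' := answer _). set (s0 := St _ _ _).
    assert (G : forall k, rec s0 (fun _ s => step (o n) s) k = steps o' k s0); [|apply G].
    induction k as [|k IH]; [reflexivity|].
    change (step (o n) (rec s0 (fun _ s => step (o n) s) k) = step o' (steps o' k s0)).
    rewrite IH. apply step_local. unfold o, o', answer, trunc.
    set (x := fs _). destruct (Nat.ltb_spec x (l n)).
    - now replace (S x - l n) with 0 by lia.
    - now replace (S x - l n) with (S (x - l n)) by lia. }
  unfold outcome. 
  assert (computable (fun n => rec (St (S (e n)) (e n) 0) (fun _ s => step (o n) s) (l n))).
  { apply (computable_rec (fun n => St (S (e n)) (e n) 0) (fun n _ s => step (o n) s) l); [|
      |comp]; unfold St; [comp|].
    unfold step, return_step, start_step, push, St, o. cbv zeta. comp. }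
  comp.
Qed.

(** * Truth-table functionals *)

(* The computable bounds [u] on the use and [c] on the values make the class closed under
   composition and recursion. *)
Definition tt_functional (F : real -> nat -> nat) : Prop :=
  exists p u c, computable u /\ computable c /\ (forall Z n, F Z n <= c n) /\
    forall Z O n, (forall q, q < u n -> O q = Some (Z q)) -> converges_to O p n (F Z n).

Lemma tt_functional_ext F G : (forall Z n, F Z n = G Z n) -> tt_functional F -> tt_functional G.
Proof.
  intros E (p & u & c & Hu & Hc & Hb & H). exists p, u, c.
  repeat split; auto; intros; rewrite <- E; auto.
Qed.

Lemma tt_functional_computable f : computable f -> tt_functional (fun _ => f).
Proof.
  intros Hf. destruct (Hf) as [p Hp]. exists p, (fun _ => 0), f.
  repeat split; auto; [apply computable_const|].
  intros Z O n _. exact (converges_mono _ _ _ _ _ (extends_no_oracle O) (Hp n)).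
Qed.

(** The inner value depends on the oracle but is at most [c' n]; summing the bounds of [F] over all
    candidates covers every case. *)
Lemma tt_functional_app F G :
  tt_functional F -> tt_functional G -> tt_functional (fun Z n => F Z (G Z n)).
Proof.
  intros (p & u & c & Hu & Hc & Hb & H) (p' & u' & c' & Hu' & Hc' & Hb' & H').
  exists (PComp p p'), (fun n => u' n + sum (S (c' n)) (fun i => u i)),
    (fun n => sum (S (c' n)) (fun i => c i)).
  split; [comp|]. split; [comp|]. split.
  - intros Z n. etransitivity; [apply Hb|].
    apply (sum_ge _ (fun i => c i)). specialize (Hb' Z n). lia.
  - intros Z O n HO. eapply converges_comp; [apply H'; intros; apply HO; lia|].
    apply H. intros q Hq. apply HO. specialize (Hb' Z n).
    pose proof (sum_ge (S (c' n)) (fun i => u i) (G Z n)). lia.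
Qed.

Lemma tt_functional_comp f G : computable f -> tt_functional G -> tt_functional (fun Z n => f (G Z n)).
Proof. intros Hf. apply (tt_functional_app (fun _ => f)). now apply tt_functional_computable. Qed.

Lemma tt_functional_id : tt_functional (fun _ n => n).
Proof. apply (tt_functional_computable (fun n => n)). comp. Qed.

Lemma tt_functional_pair F G :
  tt_functional F -> tt_functional G -> tt_functional (fun Z n => pair (F Z n) (G Z n)).
Proof.
  intros (p & u & c & Hu & Hc & Hb & H) (p' & u' & c' & Hu' & Hc' & Hb' & H').
  exists (PPair p p'), (fun n => u n + u' n), (fun n => pair (c n) (c' n)).
  split; [comp|]. split; [comp|]. split.
  - intros; apply pair_mono; auto.
  - intros Z O n HO. apply converges_pair; [apply H|apply H']; intros; apply HO; lia.
Qed.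

Lemma tt_functional_oracle G : tt_functional G -> tt_functional (fun Z n => b2n (Z (G Z n))).
Proof.
  apply (tt_functional_app (fun Z n => b2n (Z n))).
  exists POracle, (fun n => S n), (fun _ => 1). split; [comp|]. split; [comp|]. split.
  - intros Z n; destruct (Z n); lia.
  - intros Z O n HO. apply converges_oracle, HO. lia.
Qed.

Lemma tt_functional_comp2 (f : nat -> nat -> nat) F G :
  computable (fun z => f (fs z) (sn z)) -> tt_functional F -> tt_functional G ->
  tt_functional (fun Z n => f (F Z n) (G Z n)).
Proof.
  intros Hf HF HG.
  apply (tt_functional_ext (fun Z n => (fun z => f (fs z) (sn z)) (pair (F Z n) (G Z n)))).
  { intros Z n. now rewrite fs_pair, sn_pair. }
  apply (tt_functional_comp (fun z => f (fs z) (sn z))); auto using tt_functional_pair.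
Qed.

Lemma tt_functional_ifz T F G :
  tt_functional T -> tt_functional F -> tt_functional G ->
  tt_functional (fun Z n => ifz (T Z n) (F Z n) (G Z n)).
Proof.
  intros HT HF HG.
  apply (tt_functional_ext (fun Z n => (fun t z => ifz t (fs z) (sn z)) (T Z n) (pair (F Z n) (G Z n)))).
  { intros Z n. now rewrite fs_pair, sn_pair. }
  apply (tt_functional_comp2 (fun t z => ifz t (fs z) (sn z))); auto using tt_functional_pair. comp.
Qed.

Lemma tt_functional_rec a (g : real -> nat -> nat -> nat) :
  tt_functional (fun Z z => g Z (fs z) (sn z)) -> tt_functional (fun Z n => rec a (g Z) n).
Proof.
  intros (p & u & c & Hu & Hc & Hb & H).
  (* [C] bounds the recursion values for all oracles at once: each stage adds the value bounds over
     every possible previous value. *)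
  set (C := fun n => rec a (fun m h => h + sum (S h) (fun i => c (pair m i))) n).
  assert (HC : computable C).
  { apply (computable_rec (fun _ => a) (fun _ m h => h + sum (S h) (fun i => c (pair m i))) (fun n => n)); comp. }
  assert (HB : forall Z n, rec a (g Z) n <= C n).
  { intros Z n. induction n as [|n IH]; [apply le_n|].
    change (g Z n (rec a (g Z) n) <= C n + sum (S (C n)) (fun i => c (pair n i))).
    specialize (Hb Z (pair n (rec a (g Z) n))). cbv beta in Hb. rewrite fs_pair, sn_pair in Hb.
    pose proof (sum_ge (S (C n)) (fun i => c (pair n i)) (rec a (g Z) n)). lia. }
  exists (PComp (PPrim (pconst a) (PComp p PSnd)) (PPair PZero PId)),
    (fun n => sum n (fun m => sum (S (C m)) (fun i => u (pair m i)))), C.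
  split; [comp|]. split; [assumption|]. split; [assumption|].
  intros Z O n HO. eapply converges_comp; [apply converges_pair; [apply converges_zero|apply converges_id]|].
  rewrite <- (sn_pair 0 n) at 2. apply converges_prim; [apply converges_pconst|].
  rewrite sn_pair. intros m Hm h. eapply converges_comp; [apply converges_snd|]. rewrite sn_pair.
  assert (E : g Z m h = (fun z : nat => g Z (fs z) (sn z)) (pair m h)) by (rewrite fs_pair, sn_pair; reflexivity).
  rewrite E. apply H. intros q Hq. apply HO.
  pose proof (sum_ge n (fun m => sum (S (C m)) (fun i => u (pair m i))) m Hm).
  pose proof (sum_ge (S (C m)) (fun i => u (pair m i)) h). specialize (HB Z m). fold h in HB. lia.
Qed.

Lemma tt_le_of_functional F (A B : real) : tt_functional F -> (forall n, F B n = b2n (A n)) -> tt_le A B.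
Proof.
  intros (p & u & c & Hu & Hc & Hb & H) E. exists p. split.
  - exists u. split; auto. intros n s Hs.
    (* The string is extended by [false] to a real; it answers every query below the use bound. *)
    exists (F (fun q => nth q s false) n). apply H. intros q Hq. unfold string_oracle.
    rewrite <- Hs in Hq. apply nth_error_nth'. exact Hq.
  - intros n. rewrite <- E. apply H. reflexivity.
Qed.

(** On oracles other than [B] the reduction may output any number. Its output is therefore cut down
    to 0 or 1, which supplies the value bound, and it is run on the prefix of length [f n], where it
    always converges. *)
Lemma functional_of_tt_le (A B : real) :
  tt_le A B -> exists F, tt_functional F /\ forall n, F B n = b2n (A n).
Proof.
  intros (Phi & (f & Hf & Ht) & HA).
  set (s := fun (Z : real) n => map Z (seq 0 (f n))).
  assert (Hs : forall Z O n, (forall q, q < f n -> O q = Some (Z q)) -> extends (string_oracle (s Z n)) O).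
  { intros Z O n HO q b Hq. unfold string_oracle, s in Hq.
    assert (q < f n).
    { rewrite <- (length_seq (f n) 0), <- (length_map Z). apply nth_error_Some. now rewrite Hq. }
    rewrite HO by assumption. rewrite nth_error_map, nth_error_seq in Hq.
    destruct (Nat.ltb_spec q (f n)); [exact Hq|lia]. }
  (* A program for the sign function. *)
  set (sg := PComp (PPrim PZero (PComp PSucc PZero)) (PPair PZero PId)).
  assert (Hsg : forall O v, converges_to O sg v (ifz v 0 1)).
  { intros O v. eapply converges_comp; [apply converges_pair; [apply converges_zero|apply converges_id]|].
    destruct v; [apply converges_prim0; rewrite ?sn_pair; auto using converges_zero|].
    replace (ifz (S v) 0 1) with (rec 0 (fun _ _ => 1) (sn (pair 0 (S v)))) by now rewrite sn_pair.
    apply converges_prim; [apply converges_zero|]. intros.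
    eapply converges_comp; [apply converges_zero|apply converges_succ]. }
  exists (fun Z n => b2n (if excluded_middle_informative
    (exists v, converges_to (string_oracle (s Z n)) Phi n (S v)) then true else false)).
  assert (HF : forall Z n v, converges_to (string_oracle (s Z n)) Phi n v ->
    b2n (if excluded_middle_informative
    (exists v, converges_to (string_oracle (s Z n)) Phi n (S v)) then true else false) = ifz v 0 1).
  { intros Z n v Hv. destruct (excluded_middle_informative _) as [[w Hw]|N].
    - now rewrite (converges_unique _ _ _ _ _ Hv Hw).
    - destruct v; [reflexivity|]. exfalso; eauto. }
  assert (Hl : forall Z n, length (s Z n) = f n).
  { intros Z n. unfold s. now rewrite length_map, length_seq. }
  split.
  - exists (PComp sg Phi), f, (fun _ => 1). split; [assumption|]. split; [comp|]. split.
    + intros Z n. destruct (excluded_middle_informative _); lia.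
    + intros Z O n HO. destruct (Ht n _ (Hl Z n)) as [v Hv]. rewrite (HF _ _ _ Hv).
      eapply converges_comp; [exact (converges_mono _ _ _ _ _ (Hs Z O n HO) Hv)|apply Hsg].
  - intros n. destruct (Ht n _ (Hl B n)) as [v Hv]. rewrite (HF _ _ _ Hv).
    apply (converges_mono _ (real_oracle B)) in Hv; [|now apply Hs].
    rewrite (converges_unique _ _ _ _ _ Hv (HA n)). now destruct (A n).
Qed.

(** * Indices of Sigma-1 predicates *)

Lemma jump_true Y e : jump Y e = true <-> exists l v, run Y l e = S v.
Proof.
  unfold jump, real_of. destruct (excluded_middle_informative _) as [[v H]|N].
  - split; [|auto]. intros _. apply run_converges in H as [l H]. eauto.
  - split; [discriminate|]. intros (l & v & H). exfalso. apply N. exists v.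
    apply run_converges. eauto.
Qed.

Lemma jump_false Y e : jump Y e = false <-> forall l, run Y l e = 0.
Proof.
  rewrite <- not_true_iff_false, jump_true. split.
  - intros N l. destruct (run Y l e) eqn:E; [reflexivity|]. exfalso; eauto.
  - intros H (l & v & E). now rewrite H in E.
Qed.

(** Turns an existential question about [Y] into a single question to [Y'], computably in the
    parameter [w] and with an index independent of [Y]. *)
Lemma sigma1_index F :
  tt_functional F ->
  exists q, computable q /\ forall Y w, jump Y (q w) = true <-> exists i, F Y (pair w i) = 0.
Proof.
  intros (p & u & c & _ & _ & _ & H).
  (* The test receives the program's own code, [w] and the candidate [i]; the code is dropped. *)
  set (r := PComp p (PPair (PComp PSnd PFst) PSnd)).
  exists (smn (PMu r)). split; [apply computable_smn|]. intros Y w.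
  set (O := real_oracle Y).
  assert (Hr : forall x i, converges_to O r (pair (pair x w) i) (F Y (pair w i))).
  { intros x i. eapply converges_comp; [|apply H; reflexivity]. apply converges_pair.
    - eapply converges_comp; [apply converges_fst|]. rewrite fs_pair. rewrite <- (sn_pair x w) at 2. apply converges_snd.
    - rewrite <- (sn_pair (pair x w) i) at 2. apply converges_snd. }
  assert (E : jump Y (smn (PMu r) w) = true <->
              converges O (PMu r) (pair (smn (PMu r) w) w)).
  { unfold jump, real_of. fold O.
    destruct (excluded_middle_informative _) as [[v Hv]|N]; (split; [|try discriminate; auto]).
    - intros _. exists v. now apply converges_smn.
    - discriminate.
    - intros [v Hv]. exfalso. apply N. exists v. now apply converges_smn. }
  rewrite E. split.
  - intros [i Hi]. exists i. apply converges_mu_inv in Hi. exact (converges_unique _ _ _ _ _ (Hr _ i) Hi).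
  - intros [i Hi].
    destruct (converges_mu_total O r _ (fun i => F Y (pair w i)) (Hr (smn (PMu r) w)) i Hi) as (j & Hj & _).
    now exists j.
Qed.

(** * Pi-0-1 classes *)

(* Finite sets of indices are coded as bit masks. *)
Definition insert (e L : nat) : nat := ifz (b2n (Nat.testbit L e)) (L + 2 ^ e) L.

Lemma testbit_insert e L i : Nat.testbit (insert e L) i = Nat.testbit L i || (e =? i).
Proof.
  unfold insert. destruct (Nat.testbit L e) eqn:E; cbn [ifz].
  - destruct (Nat.eqb_spec e i) as [<-|]; [now rewrite E|now rewrite orb_false_r].
  - rewrite Nat.add_nocarry_lxor.
    + rewrite Nat.lxor_spec, Nat.pow2_bits_eqb.
      destruct (Nat.eqb_spec e i) as [<-|]; [now rewrite E|now rewrite orb_false_r, xorb_false_r].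
    + apply Nat.bits_inj. intros j. rewrite Nat.land_spec, Nat.pow2_bits_eqb, Nat.bits_0.
      destruct (Nat.eqb_spec e j) as [<-|]; [now rewrite E|apply andb_false_r].
Qed.

Lemma computable_insert f g : computable f -> computable g -> computable (fun n => insert (f n) (g n)).
Proof. intros Hf Hg. unfold insert. comp. Qed.
#[local] Hint Extern 1 (computable (fun n => insert _ _)) => apply computable_insert; comp : comp.

Lemma testbit_lt L e : Nat.testbit L e = true -> e < L.
Proof.
  intros H. destruct (Nat.lt_ge_cases e L) as [|Hle]; [assumption|]. exfalso.
  assert (Nat.testbit L e = false); [|congruence].
  apply Nat.testbit_false. rewrite Nat.div_small; [reflexivity|].
  pose proof (Nat.pow_gt_lin_r 2 e). lia.
Qed.

(** Makes level [l] of the binary tree a finite set of numbers, over which [covered] can sum. *)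
Lemma prefix_code (Z : real) l : exists c, c < 2 ^ l /\ forall q, q < l -> Nat.testbit c q = Z q.
Proof.
  induction l as [|l (c & Hc & H)]; [exists 0; split; [simpl; lia|intros; lia]|].
  assert (Hl : Nat.testbit c l = false).
  { apply Nat.testbit_false. now rewrite Nat.div_small. }
  exists (if Z l then insert l c else c). rewrite Nat.pow_succ_r'. split.
  - unfold insert. rewrite Hl. cbn [ifz]. destruct (Z l); lia.
  - intros q Hq. destruct (Nat.eq_dec q l) as [->|].
    + destruct (Z l); [|assumption]. now rewrite testbit_insert, Nat.eqb_refl, orb_true_r.
    + rewrite <- (H q) by lia. destruct (Z l); [|reflexivity].
      rewrite testbit_insert. destruct (Nat.eqb_spec l q); [lia|apply orb_false_r].
Qed.

(** All constraints take this form of divergence: fixed bits enter [L] through [bit_index] and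
    diagonal non-recursiveness through [diagonal_index]. *)
Definition in_class (L : nat) (Y : real) : Prop :=
  forall e, Nat.testbit L e = true -> jump Y e = false.

Lemma in_class_insert e L Y : in_class (insert e L) Y <-> jump Y e = false /\ in_class L Y.
Proof.
  unfold in_class. split.
  - intros H. split; [|intros e' He']; apply H; rewrite testbit_insert.
    + now rewrite Nat.eqb_refl, orb_true_r.
    + now rewrite He'.
  - intros [He H] e'. rewrite testbit_insert. intros He'.
    apply orb_true_iff in He' as [|E]; [auto|]. apply Nat.eqb_eq in E. now subst.
Qed.

(* [covered L l = 0] says that level [l] of the tree already witnesses emptiness of the class. *)
Definition covered (L l : nat) : nat :=
  sum (2 ^ l) (fun c =>
    ifz (sum L (fun e => ifz (b2n (Nat.testbit L e)) 0 (run (Nat.testbit c) l e))) 1 0).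

#[local] Hint Extern 1 (computable (fun n => run _ _ _)) => apply computable_run; comp : comp.

Lemma computable_covered f g : computable f -> computable g -> computable (fun n => covered (f n) (g n)).
Proof.
  intros Hf Hg. unfold covered.
  apply (computable_sum (fun n c => ifz (sum (f n) (fun e =>
    ifz (b2n (Nat.testbit (f n) e)) 0 (run (Nat.testbit c) (g n) e))) 1 0)); [comp|].
  apply computable_ifz; [|comp|comp].
  apply (computable_sum (fun z e => ifz (b2n (Nat.testbit (f (fs z)) e)) 0
    (run (Nat.testbit (sn z)) (g (fs z)) e))); comp.
Qed.
#[local] Hint Extern 1 (computable (fun n => covered _ _)) => apply computable_covered; comp : comp.

(** A run at level [l] reads only the first [l] bits, so the [2 ^ l] prefixes stand for all
    reals. *)
Lemma covered_spec L l :
  covered L l = 0 <-> forall Z, exists e, Nat.testbit L e = true /\ run Z l e <> 0.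
Proof.
  unfold covered. rewrite sum_zero. split.
  - intros H Z. destruct (prefix_code Z l) as (c & Hc & E). specialize (H c Hc).
    destruct (sum _ _) eqn:Es in H; [discriminate|]. apply NNPP. intros N.
    assert (Hz : sum L (fun e => ifz (b2n (Nat.testbit L e)) 0 (run (Nat.testbit c) l e)) = 0);
      [|congruence].
    apply sum_zero. intros e _. destruct (Nat.testbit L e) eqn:Ee; [|reflexivity]. cbn [ifz].
    rewrite (run_agree _ Z) by exact E. destruct (run Z l e) eqn:Er; [reflexivity|].
    exfalso. apply N. exists e. now rewrite Er.
  - intros H c Hc. destruct (sum _ _) eqn:Es; [|reflexivity]. exfalso.
    destruct (H (Nat.testbit c)) as (e & He & Hr). apply Hr.
    rewrite sum_zero in Es. specialize (Es e (testbit_lt _ _ He)). now rewrite He in Es.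
Qed.

(** Kőnig's lemma for the binary tree: condition [G l] depends on the first [l] bits only, and a
    path is built through prefixes that extend to members of every level. *)
Lemma compactness (G : nat -> real -> Prop) :
  (forall l Y Z, (forall q, q < l -> Y q = Z q) -> G l Y -> G l Z) ->
  (forall l Y, G (S l) Y -> G l Y) ->
  (forall l, exists Y, G l Y) -> exists Y, forall l, G l Y.
Proof.
  intros Hext Hdec Hex.
  assert (Hmono : forall l m Y, l <= m -> G m Y -> G l Y).
  { intros l m Y Hlm. induction Hlm; auto. }
  set (ext l (Y : real) := forall m, exists Z, (forall q, q < l -> Z q = Y q) /\ G m Z).
  set (upd (Y : real) l b := (fun q => if q =? l then b else Y q) : real).
  set (y := nat_rect (fun _ => real) empty_real (fun l Y => upd Y l
    (if excluded_middle_informative (ext (S l) (upd Y l true)) then true else false))).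
  assert (Hy : forall l, ext l (y l)).
  { induction l as [|l IH].
    - intros m. destruct (Hex m) as [Z HZ]. exists Z. split; [intros; lia|exact HZ].
    - change (y (S l)) with (upd (y l) l
        (if excluded_middle_informative (ext (S l) (upd (y l) l true)) then true else false)).
      destruct (excluded_middle_informative _) as [|N]; [assumption|].
      (* If bit 1 fails at level [m0], every member of a level beyond [m0] through this prefix must
         have bit 0. *)
      apply not_all_ex_not in N as [m0 N]. intros m.
      destruct (IH (m0 + m)) as (Z & HZ & HG).
      assert (EZ : forall b, Z l = b -> forall q, q < S l -> Z q = upd (y l) l b q).
      { intros b Hb q Hq. unfold upd. destruct (Nat.eqb_spec q l) as [->|]; [assumption|].
        apply HZ; lia. }
      exists Z. destruct (Z l) eqn:Ez.
      + exfalso. apply N. exists Z. split; [now apply EZ|apply (Hmono _ (m0 + m)); [lia|assumption]].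
      + split; [now apply EZ|apply (Hmono _ (m0 + m)); [lia|assumption]]. }
  (* Bit [q] is set at stage [S q] and never changed afterwards. *)
  exists (fun q => y (S q) q). intros l. destruct (Hy l l) as (Z & HZ & HG).
  apply (Hext l Z); [|assumption]. intros q Hq. rewrite HZ by assumption.
  clear -Hq. induction Hq; [reflexivity|].
  rewrite <- IHHq. unfold y at 1. cbn [nat_rect]. fold (y m). unfold upd at 1.
  destruct (Nat.eqb_spec q m); [lia|reflexivity].
Qed.

(** Compactness is applied along the diagonal: at level [l] the constraints [L l] are tested for [l]
    steps, so one path serves all the classes. *)
Lemma class_nested (L : nat -> nat) :
  (forall i e, Nat.testbit (L i) e = true -> Nat.testbit (L (S i)) e = true) ->
  (forall i l, covered (L i) l <> 0) -> exists Y, forall i, in_class (L i) Y.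
Proof.
  intros Hinc Hne.
  assert (Hmono : forall i j e, i <= j -> Nat.testbit (L i) e = true -> Nat.testbit (L j) e = true).
  { intros i j e Hij. induction Hij; auto. }
  assert (Hrun : forall Y l m e, l <= m -> run Y m e = 0 -> run Y l e = 0).
  { intros Y l m e Hlm H. destruct (run Y l e) eqn:E; [reflexivity|].
    apply (run_mono _ _ m) in E; [congruence|assumption]. }
  destruct (compactness (fun l Y => forall e, Nat.testbit (L l) e = true -> run Y l e = 0)) as [Y HY].
  - intros l Y Z E H e He. rewrite (run_agree Z Y); [auto|]. intros; symmetry; auto.
  - intros l Y H e He. apply (Hrun Y l (S l)); auto.
  - intros l. apply NNPP. intros N. apply (Hne l l). apply covered_spec. intros Z.
    apply NNPP. intros N'. apply N. exists Z. intros e He.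
    destruct (run Z l e) eqn:E; [reflexivity|]. exfalso. apply N'. exists e. now rewrite E.
  - exists Y. intros i e He. apply jump_false. intros l.
    apply (Hrun Y l (l + i)); [lia|]. apply HY. apply (Hmono i); [lia|assumption].
Qed.

Lemma class_empty L : (exists l, covered L l = 0) <-> ~ exists Y, in_class L Y.
Proof.
  split.
  - intros (l & Hl) (Y & HY). rewrite covered_spec in Hl. destruct (Hl Y) as (e & He & Hr).
    apply Hr. now apply jump_false, HY.
  - intros N. apply NNPP. intros N'. apply N.
    destruct (class_nested (fun _ => L)) as [Y HY]; [auto|eauto|exists Y; apply (HY 0)].
Qed.

(** * Coding positions *)

Lemma run_bits_0 l e : run (Nat.testbit 0) l e = run empty_real l e.
Proof. apply run_agree. intros. apply Nat.bits_0. Qed.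

(** By compactness emptiness is an existential statement about [covered]. It makes no use of [Y], so
    with the empty oracle [0'] decides it. *)
Lemma emptiness_index :
  exists q, computable q /\ forall Y L, jump Y (q L) = true <-> ~ exists Z, in_class L Z.
Proof.
  destruct (sigma1_index (fun _ z => covered (fs z) (sn z))) as (q & Hq & E).
  { apply tt_functional_computable. comp. }
  exists q. split; [assumption|]. intros Y L. rewrite E, <- class_empty.
  split; intros [l Hl]; exists l; revert Hl; now rewrite fs_pair, sn_pair.
Qed.

Lemma halting_index : exists g, computable g /\ forall Y m, jump Y (g m) = halting m.
Proof.
  destruct (sigma1_index (fun _ z => ifz (run (Nat.testbit 0) (sn z) (fs z)) 1 0)) as (g & Hg & E).
  { apply (tt_functional_computable (fun z => ifz (run (Nat.testbit 0) (sn z) (fs z)) 1 0)). comp. }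
  exists g. split; [assumption|]. intros Y m. apply eq_true_iff_eq. unfold halting.
  rewrite E, jump_true. split.
  - intros [l Hl]. exists l. rewrite fs_pair, sn_pair, run_bits_0 in Hl.
    destruct (run empty_real l m) as [|v]; [discriminate|]. now exists v.
  - intros (l & v & Hl). exists l. now rewrite fs_pair, sn_pair, run_bits_0, Hl.
Qed.

(** The program halts exactly when the bit differs from [b]. Fixing a bit thus becomes a divergence
    constraint, and [Y'] can read the bits of [Y]. *)
Lemma bit_index :
  exists h, computable h /\ forall Y k b, jump Y (h (pair k b)) = false <-> b2n (Y k) = b.
Proof.
  destruct (sigma1_index (fun Y z =>
    ifz ((b2n (Y (fs (fs z))) - sn (fs z)) + (sn (fs z) - b2n (Y (fs (fs z))))) 1 0)) as (h & Hh & E).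
  { apply (tt_functional_ifz (fun Y z => b2n (Y (fs (fs z))) - sn (fs z) + (sn (fs z) - b2n (Y (fs (fs z)))))
      (fun _ _ => 1) (fun _ _ => 0)); try (apply (tt_functional_computable (fun _ => _)); comp).
    apply (tt_functional_comp2 (fun a b => a - b + (b - a)) (fun Y z => b2n (Y (fs (fs z))))
      (fun _ z => sn (fs z))); [comp| |apply (tt_functional_computable (fun z => sn (fs z))); comp].
    apply (tt_functional_oracle (fun _ z => fs (fs z))), (tt_functional_computable (fun z => fs (fs z))). comp. }
  exists h. split; [assumption|]. intros Y k b. rewrite <- not_true_iff_false, E.
  split.
  - intros N. destruct (Nat.eq_dec (b2n (Y k)) b); [assumption|]. exfalso. apply N. exists 0.
    rewrite !fs_pair, sn_pair. destruct (b2n (Y k) - b + (b - b2n (Y k))) eqn:D; [lia|reflexivity].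
  - intros <- [i Hi]. now rewrite !fs_pair, sn_pair, Nat.sub_diag in Hi.
Qed.

Lemma diagonal_index :
  exists e0, forall Y, jump Y e0 = false <->
    forall k, ~ converges_to (real_oracle empty_real) (decode k) k (b2n (Y k)).
Proof.
  (* [D a b] is the distance from [a] to [S b]; it is zero when the bounded run has returned [b]. *)
  set (D := fun a b => a - S b + (S b - a)).
  destruct (sigma1_index (fun Y z =>
    D (run (Nat.testbit 0) (sn (sn z)) (fs (sn z))) (b2n (Y (fs (sn z)))))) as (q & _ & E).
  { apply (tt_functional_comp2 D (fun _ z => run (Nat.testbit 0) (sn (sn z)) (fs (sn z)))
      (fun Y z => b2n (Y (fs (sn z))))).
    - unfold D. comp.
    - apply (tt_functional_computable (fun z => run (Nat.testbit 0) (sn (sn z)) (fs (sn z)))). comp.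
    - apply (tt_functional_oracle (fun _ z => fs (sn z))), (tt_functional_computable (fun z => fs (sn z))). comp. }
  exists (q 0). intros Y. rewrite <- not_true_iff_false, E. split.
  - intros N k Hk. apply N. apply run_converges in Hk as [l Hl]. exists (pair k l).
    rewrite !sn_pair, fs_pair, run_bits_0, Hl. unfold D. lia.
  - intros N [i Hi]. apply (N (fs (sn (pair 0 i)))). apply run_converges.
    exists (sn (sn (pair 0 i))). rewrite run_bits_0 in Hi. unfold D in Hi. lia.
Qed.

(* On a class of diagonally non-recursive sets, [pos L] is the index of a program that waits for
   one of the values of bit [pos L] to be excluded from the class and outputs the other one; the
   diagonal requirement then excludes that one as well. *)
Lemma coding_position e0 h :
  computable h ->
  (forall Y, jump Y e0 = false ->
     forall k, ~ converges_to (real_oracle empty_real) (decode k) k (b2n (Y k))) ->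
  (forall Y k b, jump Y (h (pair k b)) = false <-> b2n (Y k) = b) ->
  exists pos, computable pos /\ forall L (b : bool),
    Nat.testbit L e0 = true -> (exists Y, in_class L Y) ->
    exists Y, in_class (insert (h (pair (pos L) (b2n b))) L) Y.
Proof.
  intros Ch H0 Hh.
  (* Here [z] codes the bit position, which will be the program's own code, the index set [L], and a
     level at which the class with that bit fixed to [b] is tested for emptiness. *)
  set (cov := fun z b => covered (insert (h (pair (fs (fs z)) b)) (sn (fs z))) (sn z)).
  assert (Hcov : forall b, computable (fun z => cov z b)) by (intros b; unfold cov; comp).
  assert (Hr : computable (fun z => cov z 0 * cov z 1)) by (pose proof (Hcov 0); pose proof (Hcov 1); comp).
  (* The output is 1 if value 0 was seen to be excluded, and 0 otherwise. *)
  assert (Ho : computable (fun z => ifz (cov z 0) 1 0)) by (pose proof (Hcov 0); comp).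
  destruct Hr as [r Hr], Ho as [out Ho].
  set (p := PComp out (PPair PId (PMu r))).
  exists (smn p). split; [apply computable_smn|]. intros L b He0 [Y0 HY0]. set (k := smn p L).
  set (O := real_oracle empty_real).
  apply NNPP. intros N. apply class_empty in N as [l Hl].
  set (T := fun i => cov (pair (pair k L) i) 0 * cov (pair (pair k L) i) 1).
  (* If fixing the bit to [b] empties the class, the search of program [k] halts. *)
  assert (Hi : T l = 0).
  { unfold T, cov. rewrite !fs_pair, !sn_pair. destruct b; rewrite Hl; lia. }
  destruct (converges_mu_total O r (pair k L) T) with (i := l) as (j & Hj & Ej); [|assumption|].
  { intros i. exact (converges_mono _ _ _ _ _ (extends_no_oracle O) (Hr _)). }
  assert (Hk : converges_to O (decode k) k (ifz (cov (pair (pair k L) j) 0) 1 0)).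
  { apply converges_smn. eapply converges_comp; [apply converges_pair; [apply converges_id|exact Hj]|].
    exact (converges_mono _ _ _ _ _ (extends_no_oracle O) (Ho _)). }
  assert (Hc : forall b', cov (pair (pair k L) j) b' = 0 -> b2n (Y0 k) <> b').
  { intros b' Hb' E. unfold cov in Hb'. rewrite !fs_pair, !sn_pair in Hb'.
    assert (M : exists l, covered (insert (h (pair k b')) L) l = 0) by (exists j; exact Hb').
    apply class_empty in M. apply M. exists Y0. apply in_class_insert. split; [|assumption].
    now apply Hh. }
  (* The member [Y0] avoids the excluded value, so its bit at [k] is the output of program [k],
     against the diagonal requirement. *)
  apply (H0 Y0 (HY0 _ He0) k). fold O.
  destruct (cov (pair (pair k L) j) 0) eqn:E0; cbn [ifz] in Hk.
  - specialize (Hc 0 E0). destruct (Y0 k); [exact Hk|congruence].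
  - unfold T in Ej. apply Nat.eq_mul_0 in Ej as [Ej|Ej]; [congruence|].
    specialize (Hc 1 Ej). destruct (Y0 k); [congruence|exact Hk].
Qed.

(** Supplies a member of the initial class of the construction. *)
Lemma diagonal_nonempty :
  exists Y : real, forall k, ~ converges_to (real_oracle empty_real) (decode k) k (b2n (Y k)).
Proof.
  exists (fun k => if excluded_middle_informative
    (converges_to (real_oracle empty_real) (decode k) k 0) then true else false).
  intros k H. destruct (excluded_middle_informative _) as [H'|N]; [|contradiction].
  now pose proof (converges_unique _ _ _ _ _ H H').
Qed.

(** * The inversion *)

Lemma join_even A B n : join A B (2 * n) = A n.
Proof. unfold join. now rewrite Nat.even_mul, Nat.div2_double. Qed.

Lemma join_odd A B n : join A B (S (2 * n)) = B n.
Proof.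
  unfold join. now rewrite Nat.even_succ, <- Nat.negb_even, Nat.even_mul, Nat.div2_succ_double.
Qed.

Theorem mainTheorem2 (X : real) (hX : tt_le halting X) :
  exists Y : real,
    tt_equiv (join Y halting) (jump Y) /\ tt_equiv (jump Y) X.
Proof.
  destruct emptiness_index as (q & Cq & Hq), halting_index as (g & Cg & Hg),
    bit_index as (h & Ch & Hh), diagonal_index as (e0 & He0).
  destruct (coding_position e0 h Ch (fun Y => proj1 (He0 Y)) Hh) as (pos & Ck & Hpos).
  (* A stage fixes the coding bit first and then asks about requirement [i]; the answer 0, for a
     nonempty class, imposes it. *)
  set (fix_bit := fun b L => insert (h (pair (pos L) b)) L).
  set (query := fun i b L => q (insert i (fix_bit b L))).
  set (next := fun i b a L => ifz a (insert i (fix_bit b L)) (fix_bit b L)).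
  set (L0 := insert e0 0).
  (* The sources of the coded bits and of [0'] are parameters, so that the construction can be rerun
     from other oracles. The bit source also sees the current set, since reading a bit off [Y] takes
     the position [pos L]. *)
  set (state := fun (B : nat -> nat -> nat) (H : nat -> nat) =>
    rec L0 (fun i L => next i (B i L) (H (query i (B i L) L)) L)).
  set (BX := fun i (_ : nat) => b2n (X i)). set (H0 := fun m => b2n (halting m)).
  set (L := state BX H0).
  assert (LS : forall i, L (S i) =
    next i (b2n (X i)) (b2n (halting (query i (b2n (X i)) (L i)))) (L i)) by reflexivity.
  assert (Linc : forall i e, Nat.testbit (fix_bit (b2n (X i)) (L i)) e = true ->
    Nat.testbit (L (S i)) e = true).
  { intros i e He. rewrite LS. unfold next. destruct (halting _); cbn [ifz]; [assumption|].
    now rewrite testbit_insert, He. }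
  assert (Linc' : forall i e, Nat.testbit (L i) e = true -> Nat.testbit (L (S i)) e = true).
  { intros i e He. apply Linc. unfold fix_bit. now rewrite testbit_insert, He. }
  assert (Le0 : forall i, Nat.testbit (L i) e0 = true).
  { induction i; [|auto]. change (L 0) with L0. unfold L0.
    now rewrite testbit_insert, Nat.eqb_refl, orb_true_r. }
  assert (Lne : forall i, exists Y, in_class (L i) Y).
  { induction i as [|i IH].
    - destruct diagonal_nonempty as [Y HY]. exists Y. apply in_class_insert.
      split; [now apply He0|]. intros e. now rewrite Nat.bits_0.
    - rewrite LS. unfold next. destruct (halting _) eqn:E; cbn [ifz].
      + now apply Hpos.
      + apply NNPP. intros N. apply (Hq empty_real) in N.
        unfold query, halting in E. congruence. }
  destruct (class_nested L Linc') as [Y HY].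
  { intros i l E. assert (M : exists l, covered (L i) l = 0) by eauto.
    apply class_empty in M. auto. }
  assert (YX : forall i, Y (pos (L i)) = X i).
  { intros i. assert (E : b2n (Y (pos (L i))) = b2n (X i)); [|now destruct (Y _), (X i)].
    apply Hh, (HY (S i)), Linc. unfold fix_bit.
    now rewrite testbit_insert, Nat.eqb_refl, orb_true_r. }
  (* A positive answer means that no member of the current class, in particular not [Y], makes
     program [i] diverge; a negative one puts the divergence among the constraints on [Y]. *)
  assert (YJ : forall i, jump Y i = halting (query i (b2n (X i)) (L i))).
  { intros i. destruct (halting _) eqn:E.
    - apply Hq in E. apply not_false_iff_true. intros N. apply E. exists Y.
      apply in_class_insert. split; [assumption|]. intros e He. apply (HY (S i)). auto.
    - apply (HY (S i)). rewrite LS, E. unfold next. cbn [ifz].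
      now rewrite testbit_insert, Nat.eqb_refl, orb_true_r. }
  (* Any [Z] that computes both the bits [X i] at stage [L i] and [halting] by truth tables
     can rerun the construction. *)
  assert (R : forall (Z : real) B H, tt_functional (fun Z z => B Z (fs z) (sn z)) -> tt_functional H ->
    (forall i, B Z i (L i) = b2n (X i)) -> (forall m, H Z m = b2n (halting m)) ->
    tt_le (jump Y) Z /\ tt_le X Z).
  { intros Z B H HB HH EB EH.
    assert (Es : forall i, state (B Z) (H Z) i = L i).
    { induction i as [|i IH]; [reflexivity|]. rewrite LS.
      change (state (B Z) (H Z) (S i)) with (let s := state (B Z) (H Z) i in
        next i (B Z i s) (H Z (query i (B Z i s) s)) s). cbv zeta. now rewrite IH, EB, EH. }
    set (b := fun Z z => B Z (fs z) (sn z)) in HB.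
    assert (Tf : tt_functional (fun Z z => fix_bit (b Z z) (sn z))).
    { apply (tt_functional_comp2 fix_bit b (fun _ z => sn z)); [unfold fix_bit; comp|assumption|].
      apply (tt_functional_computable (fun z => sn z)). comp. }
    assert (Ti : tt_functional (fun Z z => insert (fs z) (fix_bit (b Z z) (sn z)))).
    { apply (tt_functional_comp2 insert (fun _ z => fs z) (fun Z z => fix_bit (b Z z) (sn z))); [comp| |assumption].
      apply (tt_functional_computable (fun z => fs z)). comp. }
    assert (Ta : tt_functional (fun Z z => H Z (query (fs z) (b Z z) (sn z)))).
    { apply (tt_functional_app H (fun Z z => query (fs z) (b Z z) (sn z))); [assumption|].
      unfold query. now apply (tt_functional_comp q (fun Z z => insert (fs z) (fix_bit (b Z z) (sn z)))). }
    assert (Ts : tt_functional (fun Z n => state (B Z) (H Z) n)).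
    { apply (tt_functional_rec L0 (fun Z i L => next i (B Z i L) (H Z (query i (B Z i L) L)) L)).
      unfold next. now apply (tt_functional_ifz (fun Z z => H Z (query (fs z) (b Z z) (sn z)))). }
    assert (Tp : tt_functional (fun Z n => pair n (state (B Z) (H Z) n))).
    { apply (tt_functional_pair (fun _ n => n)); [apply tt_functional_id|assumption]. }
    split.
    - apply (tt_le_of_functional _ _ _ (tt_functional_app _ _ Ta Tp)). intros i. unfold b.
      now rewrite fs_pair, sn_pair, Es, EB, EH, YJ.
    - apply (tt_le_of_functional _ _ _ (tt_functional_app _ _ HB Tp)). intros i. unfold b.
      now rewrite fs_pair, sn_pair, Es, EB. }
  (* The program that halts unless bit [n] is 0 lets [Y'] decide [Y n] by one query. *)
  assert (Yh : forall n, jump Y (h (pair n 0)) = Y n).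
  { intros n. pose proof (Hh Y n 0) as E. destruct (Y n).
    - destruct (jump Y _); [reflexivity|]. discriminate (proj1 E eq_refl).
    - now apply E. }
  exists Y. split; split.
  (* One query to [Y'] per bit: [h] handles the even places, carrying [Y], and [g] the odd ones,
     carrying [0']. *)
  - set (f := fun n => ifz (n mod 2) (h (pair (n / 2) 0)) (g (n / 2))).
    apply (tt_le_of_functional (fun Z n => b2n (Z (f n)))).
    { apply (tt_functional_oracle (fun _ => f)), tt_functional_computable. unfold f. comp. }
    intros n. unfold f, join. rewrite Nat.div2_div.
    destruct (Nat.even n) eqn:E.
    + rewrite (proj2 (Nat.Div0.mod_divides n 2)); [now cbn [ifz]; rewrite Yh|].
      apply Nat.even_spec in E as [m E]. eauto.
    + rewrite <- Nat.negb_odd in E. apply negb_false_iff, Nat.odd_spec in E as [m Em].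
      assert (En : n mod 2 = 1) by (rewrite Em, Nat.add_comm, Nat.mul_comm; apply Nat.Div0.mod_add).
      rewrite En. cbn [ifz]. now rewrite Hg.
  (* From the join, the bit [X i] is read in the half of [Y] at the coding position. *)
  - apply (R _ (fun Z _ s => b2n (Z (2 * pos s))) (fun Z m => b2n (Z (S (2 * m))))).
    + apply (tt_functional_oracle (fun _ z => 2 * pos (sn z))), tt_functional_computable. comp.
    + apply (tt_functional_oracle (fun _ m => S (2 * m))), tt_functional_computable.
      apply computable_S, computable_mul; comp.
    + intros i. now rewrite join_even, YX.
    + intros m. now rewrite join_odd.
  (* From [X] the coded bits are immediate, and the hypothesis on [X] supplies [0']. *)
  - destruct (functional_of_tt_le _ _ hX) as (F & TF & EF).
    apply (R X (fun Z i _ => b2n (Z i)) F); auto.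
    apply (tt_functional_oracle (fun _ z => fs z)), tt_functional_computable. comp.
  (* From [Y'] the coded bits are obtained through [h] and [0'] through [g]. *)
  - apply (R (jump Y) (fun Z _ s => b2n (Z (h (pair (pos s) 0)))) (fun Z m => b2n (Z (g m)))).
    + apply (tt_functional_oracle (fun _ z => h (pair (pos (sn z)) 0))), tt_functional_computable. comp.
    + apply (tt_functional_oracle (fun _ m => g m)), tt_functional_computable. comp.
    + intros i. now rewrite Yh, YX.
    + intros m. now rewrite Hg.
Qed.
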